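(* The canonical summable ideal $\mathrm{Sum}_{1/n}$ and the Ramsey ideal $\mathcal{R}\mathrm{am}$ are incomparable in the Gamified Katětov order. That is, $$\mathrm{Sum}_{1/n}\not\leq_{\mathrm{LT}}^{\mathsf{o}}\mathcal{R}\mathrm{am}\qquad\text{and}\qquad\mathcal{R}\mathrm{am}\not\leq_{\mathrm{LT}}^{\mathsf{o}}\mathrm{Sum}_{1/n}.$$
   Context: **The ideals.** $\mathrm{Sum}_{1/n}:=\{A\subseteq\omega : \sum_{n\in A}\frac{1}{n+1}<\infty\}$. For $B\subseteq\omega$, $[B]^2$ is the set of unordered pairs of distinct elements of $B$. The Ramsey ideal is $\mathcal{R}\mathrm{am}:=\{A\subseteq[\omega]^2 : \text{for every infinite } B\subseteq\omega,\ [B]^2\not\subseteq A\}$; it is viewed as an ideal on $\omega$ via a fixed computable bijection $[\omega]^2\simeq\omega$. **Upper sets and duals.** An upper set $\mathcal{U}\subseteq\mathcal{P}(\omega)$ is a family closed upward under $\subseteq$; a lower set is a family closed downward under $\subseteq$. An ideal is a lower set closed under finite unions. The dual upper set of a lower set $\mathcal{I}$ is $\mathcal{I}^*:=\{A\subseteq\omega : \omega\setminus A\in\mathcal{I}\}$. **Trees.** ${}^{<\omega}\omega$ is the set of finite strings of natural numbers, ${}^{\omega}\omega$ the set of infinite strings; $p\upharpoonright n$ is the prefix of $p$ of length $n$, and $\sigma^\frown n$ is $\sigma$ extended by the entry $n$. A tree is a set $T\subseteq{}^{<\omega}\omega$ containing the empty string and closed under initial segments; $[T]:=\{p\in{}^{\omega}\omega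 : p\upharpoonright n\in T\ \text{for all } n\}$. For an upper set $\mathcal{V}$, a tree $T$ is $\mathcal{V}$-branching if for every $\sigma\in T$ (including the root) $\{n\in\omega : \sigma^\frown n\in T\}\in\mathcal{V}$. **Partial continuous functions.** A partial continuous function $\Phi:\subseteq{}^{\omega}\omega\to\omega$ is one determined by a partial function $\varphi:\subseteq{}^{<\omega}\omega\to\omega$ that is coherent (if $\sigma,\tau\in\mathrm{dom}(\varphi)$ and $\sigma$ is a prefix of $\tau$ then $\varphi(\sigma)=\varphi(\tau)$), via: $p\in\mathrm{dom}(\Phi)$ and $\Phi(p)=c$ iff there is $n$ with $p\upharpoonright n\in\mathrm{dom}(\varphi)$ and $\varphi(p\upharpoonright n)=c$. **Gamified Katětov order.** For upper sets $\mathcal{U},\mathcal{V}\subseteq\mathcal{P}(\omega)$, write $\mathcal{U}\leq_{\mathrm{LT}}^{\mathsf{o}}\mathcal{V}$ iff there exists a partial continuous function $\Phi:\subseteq{}^{\omega}\omega\to\omega$ such that for every $A\in\mathcal{U}$ there is a $\mathcal{V}$-branching tree $T$ with $[T]\subseteq\mathrm{dom}(\Phi)$ and $\Phi(p)\in A$ for all $p\in[T]$. For lower sets (in particular ideals) $\mathcal{I},\mathcal{J}$, write $\mathcal{I}\leq_{\mathrm{LT}}^{\mathsf{o}}\mathcal{J}$ iff $\mathcal{I}^*\leq_{\mathrm{LT}}^{\mathsf{o}}\mathcal{J}^*$. *)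

(* Defs.v *)
From mathcomp Require Import all_boot all_order all_algebra.
From mathcomp Require Import all_classical all_reals all_analysis.

Set Implicit Arguments.
Unset Strict Implicit.
Unset Printing Implicit Defensive.

Import Order.TTheory GRing.Theory Num.Theory.

Local Open Scope classical_set_scope.

Definition upper_set (U : set (set nat)) : Prop :=
  forall A B, A `<=` B -> U A -> U B.

Definition lower_set (I : set (set nat)) : Prop :=
  forall A B, A `<=` B -> I B -> I A.

Definition dual (I : set (set nat)) : set (set nat) := [set A | I (~` A)].

Lemma upper_set_dual (I : set (set nat)) : lower_set I -> upper_set (dual I).
Proof. by move=> lI A B AB; apply: lI; apply: subsetC. Qed.

Definition is_tree (T : set (seq nat)) : Prop :=
  T [::] /\ forall s t, prefix s t -> T t -> T s.

(* [mkseq p n] is the string [p 0, ..., p (n - 1)] *)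
Definition branches (T : set (seq nat)) : set (nat -> nat) :=
  [set p | forall n, T (mkseq p n)].

Definition branching (V : set (set nat)) (T : set (seq nat)) : Prop :=
  forall s, T s -> V [set n | T (rcons s n)].

(* Partial functions are option-valued, [None] meaning undefined. *)
Definition pdom (X : Type) (f : X -> option nat) : set X :=
  [set x | exists c, f x = Some c].

Definition coherent (phi : seq nat -> option nat) : Prop :=
  forall s t, pdom phi s -> pdom phi t -> prefix s t -> phi s = phi t.

Definition partial_continuous (Phi : (nat -> nat) -> option nat) : Prop :=
  exists2 phi : seq nat -> option nat, coherent phi &
    forall p c, Phi p = Some c <-> exists n, phi (mkseq p n) = Some c.

Definition LT_upper (U V : set (set nat)) : Prop :=
  exists2 Phi : (nat -> nat) -> option nat, partial_continuous Phi &
    forall A, U A -> exists T : set (seq nat),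
      [/\ is_tree T, branching V T, branches T `<=` pdom Phi &
          forall p c, branches T p -> Phi p = Some c -> A c].

Definition LT_lower (I J : set (set nat)) : Prop := LT_upper (dual I) (dual J).

Definition summable_ideal (R : realType) : set (set nat) :=
  [set A | ((\esum_(n in A) (n.+1%:R^-1 : R)%:E)%R < +oo)%E].

Lemma lower_set_summable_ideal (R : realType) : lower_set (summable_ideal R).
Proof.
move=> A B AB; apply: le_lt_trans; apply: ereal_sup_le => _ [X [Xfin XA] <-].
by exists X => //; split=> // n /XA/AB.
Qed.

(* The unordered pair {i, j} of distinct elements of B is represented by the
   ordered pair of its elements listed increasingly. *)
Definition pairs (B : set nat) : set (nat * nat) :=
  [set ij | [/\ B ij.1, B ij.2 & ij.1 < ij.2]].

Definition ramsey_pairs : set (set (nat * nat)) :=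
  [set A | A `<=` pairs setT /\
           forall B : set nat, infinite_set B -> ~ (pairs B `<=` A)].

(* Colexicographic enumeration of the pairs i < j:
   (0,1), (0,2), (1,2), (0,3), (1,3), (2,3), ... *)
Definition pair_code (ij : nat * nat) : nat := 'C(ij.2, 2) + ij.1.

Lemma pair_code_bij : set_bij (pairs setT) setT pair_code.
Proof.
split=> // [[i j] [k l]|n _].
  rewrite !inE /pair_code /= => -[_ _ /= ij] [_ _ /= kl].
  have lt_code a b c d : a < b -> b < d -> 'C(b, 2) + a < 'C(d, 2) + c.
    move=> ab bd; have : 'C(b.+1, 2) <= 'C(d, 2) by apply: leq_bin2l.
    rewrite binS bin1 => le_bd; apply: leq_trans (leq_addr _ _).
    by apply: leq_trans le_bd; rewrite ltn_add2l.
  case: (ltngtP j l) => [jl|lj|->] e.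
  - by have := lt_code i j k l ij jl; rewrite e ltnn.
  - by have := lt_code k l i j kl lj; rewrite e ltnn.
  - by move/addnI: e => ->.
elim: n => [|n [[i j] [_ _ /= ij] <-]]; first by exists (0, 1).
have [ij1|ji] := ltnP i.+1 j; first by exists (i.+1, j); rewrite // /pair_code addnS.
have -> : j = i.+1 by apply/eqP; rewrite eqn_leq ji ij.
by exists (0, i.+2) => //; rewrite /pair_code /= addn0 (binS i.+1) bin1 addnS.
Qed.

Definition ramsey_ideal : set (set nat) :=
  [set pair_code @` A | A in ramsey_pairs].

Lemma ramsey_idealE (A : set nat) :
  ramsey_ideal A <->
  forall B : set nat, infinite_set B -> ~ (pair_code @` pairs B `<=` A).
Proof.
have [_ inj surj] := pair_code_bij.
have sub B : pairs B `<=` pairs setT by move=> x [].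
split=> [[P [PT nP] <-] B Binf BP|nA].
  apply: (nP B Binf) => x Bx; have [y Py yx] := BP _ (imageP _ Bx).
  by rewrite -(inj y x) // inE; [exact: PT | exact: sub Bx].
exists (pairs setT `&` pair_code @^-1` A); first split.
- by move=> x [].
- by move=> B Binf BA; apply: (nA B Binf) => _ [x Bx <-]; have [] := BA x Bx.
- rewrite eqEsubset; split=> [_ [x [_ Ax] <-] //|n An].
  by have [x xT xn] := surj n I; exists x; rewrite //=; split; rewrite //= xn.
Qed.

Lemma lower_set_ramsey_ideal : lower_set ramsey_ideal.
Proof.
move=> A B AB /ramsey_idealE nB; apply/ramsey_idealE => C Cinf CA.
by apply: (nB C Cinf); apply: subset_trans AB.
Qed.

(* Main.v *)
Require Import Defs.
From mathcomp Require Import all_boot all_order all_algebra.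
From mathcomp Require Import all_classical all_reals all_analysis.
From mathcomp Require Import measurable_realfun.

(** A reduction is a well-founded game. Call a string [s] forced into [A] when
    the subtree above [s] can be pruned, along sets of the filter [F], to a
    well-founded tree on all of whose leaves the function takes a value in [A].
    If [phi] witnesses that one family is below the dual [F] of an ideal, then
    the root is forced into every member of that family
    ([LT_upper_forced]). Both halves of the theorem build a member of the family
    into which the root is not forced.

    Summable is not below Ramsey. Fix a nonprincipal ultrafilter [p] on the
    natural numbers. Taking the limit along [p] first in the second and then in
    the first vertex of an edge, and iterating this along the well-founded
    recursion, gives to a string [s] at most one limit value. As the values met
    below [s] tend to this limit, or to infinity when there is none, a sparse
    set [X] can swallow, for each [s], all the new values that occur along some
    infinite complete graph below [s] ([summable_hitting]). There are countably
    many requirements, so [X] can be taken summable, and the limit value of the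
    root can be added to it. Then no
    well-founded tree avoids [X]: a set in the dual of the Ramsey ideal meets
    the complete graph chosen above, and so the avoiding player is led to
    strings whose limit value, if any, is in [X]
    ([ramsey_forced_value]).

    Ramsey is not below summable. Two-colour the vertices at random, by the
    binary digits of a real number [x]. The bichromatic edges form a graph
    without triangles, hence a member of the Ramsey ideal, but each edge belongs
    to it with a probability bounded below. This bound survives the recursion:
    if each of the events [B n] has measure at least [delta] and the weights have
    an infinite sum, then, with measure at least [delta], the weights of those
    [n] whose event occurs already have an infinite sum
    ([ge_measure_divergent_weight]). So with positive probability the tree of
    strings cannot be pruned, along cosummable sets, to one that avoids the
    random graph ([often_unforced]). *)

Set Implicit Arguments.
Unset Strict Implicit.
Unset Printing Implicit Defensive.

Import Order.TTheory GRing.Theory Num.Theory.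

Local Open Scope classical_set_scope.

(** * Forcing the value of a partial continuous function *)

(** Branching sets are quantified as [N] instead of being the whole set of
    forced successors, to keep the definition strictly positive. A string at
    which [phi] is defined is a leaf, whatever lies above it. *)
Inductive forced (phi : seq nat -> option nat) (F : set (set nat))
    (A : set nat) (s : seq nat) : Prop :=
| forced_value v of phi s = Some v & A v
| forced_step N of phi s = None & F N &
    forall n, N n -> forced phi F A (rcons s n).

Lemma forcedS phi F A s : upper_set F -> phi s = None ->
  forced phi F A s <-> F [set n | forced phi F A (rcons s n)].
Proof.
move=> uF phis; split=> [[v|N _ FN Nf]|FN]; first by rewrite phis.
- exact: uF FN.
- exact: forced_step FN _.
Qed.

Lemma forced_meet phi F A B s :
  (forall M N, F M -> F N -> M `&` N !=set0) ->
  forced phi F A s -> forced phi F B s -> A `&` B !=set0.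
Proof.
move=> FI; elim=> {s} [s v phis Av|s M phis FM _ IH].
  by case=> [w|?]; rewrite phis // => -[<-] Bv; exists v.
case=> [?|N _ FN Nf]; first by rewrite phis.
by have [n [/IH Mn /Nf]] := FI _ _ FM FN; exact: Mn.
Qed.

Lemma extend_branch (Q : set (seq nat)) (s : seq nat) : Q s ->
  (forall t, Q t -> exists n, Q (rcons t n)) ->
  exists p, [/\ mkseq p (size s) = s & forall n, size s <= n -> Q (mkseq p n)].
Proof.
move=> Qs Qnext.
have /choice[next Hnext] : forall t, exists n, Q t -> Q (rcons t n).
  by move=> t; have [/Qnext[n Qn]|nQ] := pselect (Q t); [exists n | exists 0].
pose u k := iter k (fun t => rcons t (next t)) s.
have uQ k : Q (u k) by elim: k => [//|k IH]; exact: Hnext.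
have su k : size (u k) = size s + k.
  by elim: k => [|k IH]; rewrite ?addn0 //= size_rcons IH addnS.
have pre k l : k <= l -> prefix (u k) (u l).
  elim: l => [|l IH]; first by rewrite leqn0 => /eqP->; exact: prefix_refl.
  rewrite leq_eqVlt ltnS => /orP[/eqP->|/IH kl]; first exact: prefix_refl.
  exact: prefix_trans kl (prefix_rcons _ _).
pose p n := nth 0 (u n.+1) n.
have pu k : mkseq p (size s + k) = u k.
  apply: (@eq_from_nth _ 0); rewrite size_mkseq ?su // => i ik.
  rewrite nth_mkseq // /p.
  have nth_pre a b : prefix a b -> i < size a -> nth 0 b i = nth 0 a i.
    by move=> /prefixP[c ->]; rewrite nth_cat => ->.
  have [/pre/nth_pre|/ltnW/pre/nth_pre] := leqP i.+1 k; rewrite su => -> //.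
  by rewrite addnS ltnS leq_addl.
exists p; split=> [|n sn]; first by rewrite -[X in mkseq _ X]addn0 pu.
by rewrite -(subnKC sn) pu.
Qed.

(** If the root were not forced into [A], the branching tree for [A] would
    contain an unforced string, and above each unforced string without a value
    another one: following them yields a branch outside the domain, or a string
    whose value is not in [A]. *)
Lemma LT_upper_forced (U V : set (set nat)) : upper_set V -> ~ V set0 ->
  LT_upper U V -> exists phi, forall A, U A -> forced phi V A [::].
Proof.
move=> uV V0 [Phi [phi _ PhiE] PhiU]; exists phi => A /PhiU[T].
case=> -[T0 Tpre] Tbr Tdom TA.
have Tnext t : T t -> exists n, T (rcons t n).
  move=> /Tbr Vt; apply: contrapT => nT; apply: V0.
  by apply: uV Vt => n /= Tn; apply: nT; exists n.
apply: contrapT => nf.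
pose Q t := T t /\ ~ forced phi V A t.
have [[t [v [[Tt nft] phit]]]|noval] :=
    pselect (exists t v, Q t /\ phi t = Some v).
  (* [v] is the value on any branch through [t], so it belongs to [A] and
     forces [t] *)
  have [p [pt Tp]] := extend_branch Tt Tnext.
  have pT : branches T p.
    move=> n; have [/Tp//|/ltnW nt] := leqP (size t) n.
    apply: Tpre Tt; rewrite -pt.
    have -> : mkseq p n = take n (mkseq p (size t)).
      by rewrite /mkseq -map_take take_iota (minn_idPl nt).
    exact: prefix_take.
  have Phip : Phi p = Some v by apply/PhiE; exists (size t); rewrite pt.
  by apply: nft; apply: forced_value phit _; exact: TA Phip.
have [t [Tt nft]|p [_ Qp]] := @extend_branch Q [::] (conj T0 nf).
  have phit : phi t = None.
    by case E : (phi t) => [v|//]; case: noval; exists t, v.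
  apply: contrapT => nQ; apply: nft; apply/forcedS => //.
  apply: uV (Tbr t Tt) => n /= Tn; apply: contrapT => nfn.
  by apply: nQ; exists n.
have [c /PhiE[n phin]] : pdom Phi p by apply: Tdom => n; have [] := Qp n isT.
by apply: noval; exists (mkseq p n), c; split=> //; exact: Qp.
Qed.

(** * Summable sets *)

Lemma weight_ge0 (R : realType) (n : nat) : (0 <= (n.+1%:R^-1 : R)%:E)%E.
Proof. by rewrite lee_fin invr_ge0. Qed.

Lemma le_esum_subset (R : realType) (T : choiceType) (A B : set T)
    (a : T -> \bar R) : A `<=` B ->
  ((\esum_(i in A) a i)%R <= (\esum_(i in B) a i)%R)%E.
Proof.
move=> AB; apply: ereal_sup_le => _ [X [Xfin XA] <-].
by exists X => //; split=> // n /XA/AB.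
Qed.

Lemma summable_ideal_setU (R : realType) (X Y : set nat) :
  summable_ideal R X -> summable_ideal R Y -> summable_ideal R (X `|` Y).
Proof.
rewrite /summable_ideal /= => Xfin Yfin; rewrite (esumID X (X `|` Y)); last first.
  by move=> n _; exact: weight_ge0.
apply: lte_add_pinfty.
  by apply: le_lt_trans Xfin; apply: le_esum_subset => n [].
by apply: le_lt_trans Yfin; apply: le_esum_subset => n [[|]].
Qed.

Lemma summable_ideal_set1 (R : realType) v : summable_ideal R [set v].
Proof. by rewrite /summable_ideal /= esum_set1 ?ltry// weight_ge0. Qed.

Lemma summable_exp2_code (R : realType) (X : set nat) (c : nat -> nat) :
  set_inj X c -> (forall v, X v -> 2 ^ c v <= v) -> summable_ideal R X.
Proof.
move=> cinj cX; rewrite /summable_ideal /=.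
(* [g n] is 2^-n, in the form of the geometric series with a known limit *)
pose g (n : nat) : \bar R := (2 / (2 ^ (n + 1))%:R)%:E%R.
have g0 n : (0 <= g n)%E by rewrite lee_fin divr_ge0.
apply: (@le_lt_trans _ _ ((\esum_(v in X) g (c v))%R)).
  apply: le_esum => v /cX cv; rewrite lee_fin addn1 expnS natrM invfM.
  rewrite mulrA divff ?mul1r ?pnatr_eq0// lef_pV2 ?posrE ?ltr0n ?expn_gt0//.
  by rewrite ler_nat ltnW.
rewrite -(@reindex_esum R _ _ X (c @` X) c); last by split.
apply: (@le_lt_trans _ _ ((\esum_(n in [set: nat]) g n)%R)).
  exact: le_esum_subset.
rewrite -nneseries_esumT//.
have -> : (\big[+%E/0%R]_(0 <= n <oo) g n = (2 / 2 ^+ 0 : R)%:E)%R.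
  by apply/cvg_lim => //; exact: cvg_geometric_eseries_half.
exact: ltry.
Qed.

(** Requirement [i] asks for a [b] such that each of the sets [E i b j], for [j]
    in the finite list [r i], is contained in [X]. These sets have at most one
    element, which can be made as large as desired by the choice of [b]; so the
    element that [X] receives for the pair [(i, j)] can be taken beyond
    2 to the power of the code of that pair, and [X] is summable. *)
Lemma summable_hitting (R : realType) (I J : countType) (r : I -> seq J)
    (P : I -> nat -> Prop) (E : I -> nat -> J -> set nat) :
  (forall i b j v w, E i b j v -> E i b j w -> v = w) ->
  (forall i N, exists2 b, P i b &
     forall j, j \in r i -> forall v, E i b j v -> N <= v) ->
  exists2 X, summable_ideal R X &
    forall i, exists2 b, P i b & forall j, j \in r i -> E i b j `<=` X.
Proof.
move=> Euniq Elarge.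
have /choice[b Hb] : forall i, exists b, P i b /\ forall j, j \in r i ->
    forall v, E i b j v -> 2 ^ pickle (i, j) <= v.
  move=> i; have [b Pb Eb] := Elarge i (\max_(j <- r i) 2 ^ pickle (i, j)).
  exists b; split=> // j jr v /(Eb j jr); apply: leq_trans.
  exact: leq_bigmax_seq.
pose X := [set v | exists i j, j \in r i /\ E i (b i) j v].
have /choice[c Hc] : forall v, exists c, X v ->
    exists i j, [/\ j \in r i, E i (b i) j v & c = pickle (i, j)].
  move=> v; have [[i [j [jr Ej]]]|nX] := pselect (X v); last by exists 0.
  by exists (pickle (i, j)) => _; exists i, j.
exists X; last first.
  move=> i; exists (b i); first by have [] := Hb i.
  by move=> j jr v Ev; exists i, j.
apply: (@summable_exp2_code R X c) => [v w|v /Hc[i [j [jr Ev ->]]]].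
  rewrite !inE => /Hc[i [j [_ Ev ->]]] /Hc[i' [j' [_ Ew ->]]].
  move=> /(pcan_inj pickleK)[ii jj]; move: Ew; rewrite -ii -jj.
  exact: Euniq Ev.
by have [_ /(_ j jr v Ev)] := Hb i.
Qed.

Lemma harmonic_nneseries (R : realType) :
  (\sum_(0 <= n <oo) (n.+1%:R^-1 : R)%R%:E = +oo)%E.
Proof.
apply/eqP; rewrite -leye_eq leNgt; apply/negP => sfin.
by apply: (@dvg_harmonic R); apply: nnseries_is_cvg sfin => n; rewrite invr_ge0.
Qed.

Lemma summable_ideal_setT (R : realType) : ~ summable_ideal R setT.
Proof.
rewrite /summable_ideal /= -nneseries_esumT; last by move=> n; exact: weight_ge0.
by rewrite harmonic_nneseries ltxx.
Qed.

Lemma esum_dual_summable (R : realType) (N : set nat) :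
  dual (summable_ideal R) N ->
  (\sum_(0 <= n <oo) (if n \in N then n.+1%:R^-1 else 0 : R)%R%:E = +oo)%E.
Proof.
move=> NC; rewrite nneseries_esumT; last first.
  by move=> n; case: ifP => // _; exact: weight_ge0.
apply/eqP; rewrite -leye_eq leNgt; apply/negP => Nfin.
apply: (@summable_ideal_setT R); rewrite -(setUv N).
apply: summable_ideal_setU NC.
rewrite /summable_ideal /= esum_mkcond; apply: le_lt_trans Nfin.
by apply: le_esum => n _; case: ifP.
Qed.

(** * Iterated ultrafilter limits *)

Lemma nonprincipal_ultrafilter : exists p : set (set nat),
  UltraFilter p /\ forall n, p [set m | n <= m].
Proof.
have [p [pU ple]] := ultraFilterLemma eventually_filter.
by exists p; split=> // n; apply: ple; exists n.
Qed.

Definition pair_limit (p : set (set nat)) : set (set nat) :=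
  [set N | p [set a | p [set b | N (pair_code (a, b))]]].

Lemma pair_limit_meet (p : set (set nat)) M N : ProperFilter p ->
  pair_limit p M -> pair_limit p N -> M `&` N !=set0.
Proof.
move=> pP pM pN; have [a [Ma Na]] := filter_ex (@filterI _ p _ _ _ pM pN).
have [b [Mb Nb]] := filter_ex (@filterI _ p _ _ _ Ma Na).
by exists (pair_code (a, b)).
Qed.

(** The limit at [s], iterated along the recursion of [forced]; a string without
    a limit value is thought of as having limit infinity. *)
Definition pairs_limit_value phi (p : set (set nat)) s v :=
  forced phi (pair_limit p) [set v] s.

(** The inner limit: the first vertex is fixed, the second one tends to infinity
    along [p]. *)
Definition star_limit_value phi (p : set (set nat)) s a v :=
  p [set b | pairs_limit_value phi p (rcons s (pair_code (a, b))) v].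

(** The values that appear when the vertex [b] joins the complete graph under
    construction below [s], and that are not already limit values one level up.
    A slot [Some a] stands for the edge from an old vertex [a] to [b], and [None]
    for the edges from [b] to later vertices. *)
Definition new_value phi p s (b : nat) (slot : option nat) : set nat :=
  if slot is Some a then
    [set v | pairs_limit_value phi p (rcons s (pair_code (a, b))) v /\
             ~ star_limit_value phi p s a v]
  else [set v | star_limit_value phi p s b v /\ ~ pairs_limit_value phi p s v].

Definition slots (l : seq nat) : seq (option nat) := None :: map Some l.

Lemma pairs_limit_value_unique phi p s v w : ProperFilter p ->
  pairs_limit_value phi p s v -> pairs_limit_value phi p s w -> v = w.
Proof.
move=> pP Hv Hw; have meet M N := @pair_limit_meet p M N pP.
by have [_ [-> ->]] := forced_meet meet Hv Hw.
Qed.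

Lemma new_value_unique phi p s b j v w : ProperFilter p ->
  new_value phi p s b j v -> new_value phi p s b j w -> v = w.
Proof.
case: j => [a|] pP [+ _] [+ _]; first exact: pairs_limit_value_unique.
move=> Gv Gw; have [c [cv cw]] := filter_ex (@filterI _ p _ _ _ Gv Gw).
exact: pairs_limit_value_unique cv cw.
Qed.

(** Since [p] is an ultrafilter, a number that is not the limit is avoided by
    [p]-almost all terms, and so are all the non-limits below [N]. *)
Lemma new_value_large phi p s l N : UltraFilter p -> phi s = None ->
  p [set b | forall j, j \in slots l -> forall v,
       new_value phi p s b j v -> N <= v].
Proof.
move=> pU phis; have pP := ultra_proper.
have avoid j v : p [set b | ~ new_value phi p s b j v].
  case: j => [a|].
    have [Gv|nG] := in_ultra_setVsetC [set b | pairs_limit_value phi p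
      (rcons s (pair_code (a, b))) v] pU.
      by apply: (@filterE _ p) => b [_]; exact.
    by apply: (@filterS _ p _) nG => b nb [].
  have [Gv|nG] := in_ultra_setVsetC [set b | star_limit_value phi p s b v] pU.
    apply: (@filterE _ p) => b [_]; apply.
    pose M := [set n | pairs_limit_value phi p (rcons s n) v].
    exact: (@forced_step _ _ _ _ M).
  by apply: (@filterS _ p _) nG => b nb [].
elim: N => [|N IH]; first exact: (@filterE _ p).
have : p [set b | forall j, j \in slots l -> ~ new_value phi p s b j N].
  elim: (slots l) => [|j r IHr]; first exact: (@filterE _ p).
  apply: (@filterS _ p _) (@filterI _ p _ _ _ IHr (avoid j N)) => b [hr hj] i.
  by rewrite inE => /orP[/eqP->|/hr].
move=> hN; apply: (@filterS _ p _) (@filterI _ p _ _ _ IH hN).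
move=> b [h1 h2] j jl v jv.
rewrite ltn_neqAle (h1 j jl v jv) andbT; apply/eqP => Nv.
by apply: (h2 j jl); rewrite Nv.
Qed.

(** * The summable ideal is not below the Ramsey ideal *)

(** Suppose that all limit values at [s] lie in [X]. The vertices [b n] are
    chosen one after the other, so that all the values that are new for [b n]
    and the earlier vertices lie in [X]. Then limit values at the strings
    below [s] given by the edges of the [b n] are in [X] too, as they are either
    new or limit values one level up. A set in the dual of the Ramsey ideal
    contains one of these edges, and the induction hypothesis fails there. *)
Lemma ramsey_forced_value phi p X s :
  (forall s l m, phi s = None -> exists2 b, m <= b &
     forall j, j \in slots l -> new_value phi p s b j `<=` X) ->
  forced phi (dual ramsey_ideal) (~` X) s ->
  exists2 v, ~ X v & pairs_limit_value phi p s v.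
Proof.
move=> hit; elim=> {s} [s v phis nXv|s N phis /ramsey_idealE NR _ IH].
  by exists v => //; exact: forced_value phis _.
apply: contrapT => sX.
have /choice[next Hnext] : forall l, exists b, \max_(a <- l) a < b /\
    forall j, j \in slots l -> new_value phi p s b j `<=` X.
  by move=> l; have [b] := hit s l (\max_(a <- l) a).+1 phis; exists b.
pose u n := iter n (fun l => rcons l (next l)) [::].
pose b n := next (u n).
have bu k n : k < n -> b k \in u n.
  elim: n => [//|n IHn]; rewrite ltnS leq_eqVlt /= mem_rcons inE.
  by move=> /orP[/eqP->|/IHn->]; rewrite ?eqxx ?orbT.
have blt k n : k < n -> b k < b n.
  move=> /bu bkn; have [+ _] := Hnext (u n); apply: leq_ltn_trans.
  exact: (@leq_bigmax_seq _ _ (fun=> true) id).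
have binj : injective b.
  by move=> k n bkn; case: (ltngtP k n) => // /blt; rewrite bkn ltnn.
have bX n v : star_limit_value phi p s (b n) v -> X v.
  move=> Gv; have [Hv|nHv] := pselect (pairs_limit_value phi p s v).
    by apply: contrapT => nXv; apply: sX; exists v.
  by have [_ /(_ None)] := Hnext (u n); apply.
have bbX k n v : k < n ->
    pairs_limit_value phi p (rcons s (pair_code (b k, b n))) v -> X v.
  move=> kn Hv; have [/bX//|nG] := pselect (star_limit_value phi p s (b k) v).
  have [_ /(_ (Some (b k)))] := Hnext (u n); apply=> //.
  by rewrite inE (mem_map Some_inj) bu.
apply: (NR (range b)).
  apply: contra_not infinite_nat => /(@finite_preimage _ _ _ b).
  by rewrite preimage_range; apply=> k n _ _; exact: binj.
move=> _ [[_ _] [/= [k _ <-] [n _ <-] kn] <-] /IH[v nXv Hv]; apply: nXv.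
apply: bbX Hv; rewrite ltnNge; apply/negP.
rewrite leq_eqVlt => /orP[/eqP nk|/blt]; first by rewrite nk ltnn in kn.
by rewrite ltnNge ltnW.
Qed.

Lemma summable_not_below_ramsey (R : realType) :
  ~ LT_lower (summable_ideal R) ramsey_ideal.
Proof.
move=> /LT_upper_forced[||phi Hphi].
- exact: upper_set_dual lower_set_ramsey_ideal.
- by move=> /ramsey_idealE /(_ setT infinite_nat); apply; rewrite setC0.
have [p [pU pge]] := nonprincipal_ultrafilter; have pP := ultra_proper.
pose I : countType := ({s | phi s == None} * seq nat * nat)%type.
have [||X Xsum Xhit] := @summable_hitting R I _
    (fun i => slots i.1.2) (fun i b => i.2 <= b)
    (fun i b j => new_value phi p (sval i.1.1) b j).
- by move=> i b j v w; exact: new_value_unique.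
- move=> [[[s /= /eqP phis] l] m] N.
  have large := new_value_large l N pU phis.
  by have [b [bm bN]] := filter_ex (@filterI _ p _ _ _ (pge m) large); exists b.
(* [X] controls the new values only; the limit value at the root starts the
   recursion *)
pose Y := X `|` pairs_limit_value phi p [::].
have Ysum : summable_ideal R Y.
  have [[v Hv]|nH] := pselect (exists v, pairs_limit_value phi p [::] v).
    apply: (@lower_set_summable_ideal R _ (v |` X)) => [w [|/= Hw]|].
    - by right.
    - by left; exact: pairs_limit_value_unique Hw Hv.
    exact: summable_ideal_setU (summable_ideal_set1 R v) Xsum.
  apply: (lower_set_summable_ideal _ Xsum) => w [//|Hw].
  by case: nH; exists w.
have [||v nYv Hv] := @ramsey_forced_value phi p Y [::]; last by apply: nYv; right.
- move=> s l m /eqP phis; have [b mb bX] := Xhit (exist _ s phis, l, m).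
  by exists b => // j jl v jv; left; exact: bX jl _ jv.
- by apply: Hphi; rewrite /dual /= setCK.
Qed.

(** * Weights of random sets of indices *)

Section divergent_weight.
Local Open Scope ring_scope.
Variables (d : measure_display) (T : measurableType d) (R : realType).
Variables (mu : {measure set T -> \bar R}) (w : nat -> R) (B : nat -> set T).
Hypotheses (mufin : (mu setT < +oo)%E) (w0 : forall n, 0 <= w n)
  (wdvg : (\sum_(0 <= n <oo) (w n)%:E = +oo)%E)
  (mB : forall n, measurable (B n)).

Let term n (x : T) : \bar R := ((w n)%:E * (\1_(B n) x)%:E)%E.

Let f (x : T) : \bar R := (\sum_(0 <= n <oo) term n x)%E.

Let term_ge0 n x : (0 <= term n x)%E.
Proof. by rewrite mule_ge0 // lee_fin. Qed.

Let mterm n : measurable_fun setT (term n).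
Proof.
by apply: emeasurable_funM => //; apply/measurable_EFinP; exact: measurable_indic.
Qed.

Let mf : measurable_fun setT f.
Proof. exact: (@ge0_emeasurable_sum _ _ _ setT _ xpredT). Qed.

Let f_esum x : f x = \esum_(n in [set n | B n x]) (w n)%:E.
Proof.
rewrite /f nneseries_esumT // [RHS]esum_mkcond; apply: eq_esum => n _.
rewrite /term indicE; have [Bnx|Bnx] := pselect (B n x).
  by rewrite !mem_set // mule1.
by rewrite !memNset // mule0.
Qed.

Lemma measurable_divergent_weight :
  measurable [set x | \esum_(n in [set n | B n x]) (w n)%:E = +oo%E].
Proof.
have -> : [set x | \esum_(n in [set n | B n x]) (w n)%:E = +oo%E] =
    setT `&` f @^-1` [set +oo%E].
  by rewrite setTI; apply/seteqP; split=> x /=; rewrite f_esum.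
exact: mf (emeasurable_set1 _).
Qed.

(** Let [f x] be the sum of the weights of those [n] with [x] in [B n]. If for
    some [k] the set where [f] exceeds [k] had measure less than [delta], each
    [B n] would meet the complement [Y] of that set in measure at least some
    positive [eta]; so the integral of [f] over [Y] would be at least [eta] times
    the infinite sum of the weights, although [f] is bounded by [k] on [Y]. *)
Lemma ge_measure_divergent_weight (delta : R) :
  (forall n, (delta%:E <= mu (B n))%E) ->
  (delta%:E <= mu [set x | \esum_(n in [set n | B n x]) (w n)%:E = +oo%E])%E.
Proof.
move=> muB.
have mufinE A : measurable A -> mu A \is a fin_num.
  move=> mA; rewrite ge0_fin_numE //; apply: le_lt_trans mufin.
  by apply: le_measure; rewrite ?inE.
pose F (k : nat) := [set x | (k%:R%:E < f x)%E].
have mF k : measurable (F k).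
  by rewrite -[F k]setTI; exact: emeasurable_fun_o_infty.
have FE : \bigcap_n F n =
    [set x | \esum_(n in [set n | B n x]) (w n)%:E = +oo%E].
  apply/seteqP; split=> x /=; rewrite -f_esum; last first.
    by move=> fx k _; rewrite /F /= fx ltry.
  move=> Fx.
  apply/eqyP => r r0; apply: (@le_trans _ _ (Num.truncn r).+1%:R%:E).
    by rewrite lee_fin ltW // truncnS_gt.
  by apply/ltW/Fx.
rewrite -FE.
have cvgF : (mu \o F) n @[n --> \oo] --> mu (\bigcap_n F n).
  apply: nonincreasing_cvg_mu => //.
  - by rewrite -ge0_fin_numE //; exact: mufinE.
  - by apply: bigcap_measurable => //; exists 0%N.
  - move=> m n mn; apply/subsetPset => x; apply: le_lt_trans.
    by rewrite lee_fin ler_nat.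
apply: (cvge_ge _ cvgF); apply: nearW => k /=.
rewrite leNgt; apply/negP => muF.
pose Y := ~` F k.
have mY : measurable Y by exact: measurableC.
have Yf x : Y x -> (f x <= k%:R%:E)%E by rewrite leNgt => /negP.
pose eta := delta - fine (mu (F k)).
have eta0 : 0 < eta by rewrite subr_gt0 -lte_fin fineK // mufinE.
have BY n : (eta%:E <= mu (B n `&` Y))%E.
  rewrite EFinB fineK ?mufinE // leeBlDr ?mufinE //.
  apply: (le_trans (muB n)).
  rewrite (measureDI mu (mB n) (mF k)) setDE leeD2l //.
  by apply: le_measure; rewrite ?inE //; exact: measurableI.
have intY : (\int[mu]_(x in Y) f x = +oo)%E.
  rewrite integral_nneseries //; last first.
    by move=> n; exact: measurable_funTS (mterm n).
  apply/eqP; rewrite -leye_eq.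
  rewrite -(@gt0_muley _ eta%:E) ?lte_fin // -wdvg -nneseriesZl; last first.
    by move=> n _; rewrite lee_fin.
  apply: lee_nneseries => n _ //; first by rewrite mule_ge0 // lee_fin // ltW.
  rewrite ge0_integralZl_EFin //; last first.
    by apply/measurable_EFinP; exact: measurable_indic.
  by rewrite integral_indic // muleC lee_wpmul2l // lee_fin.
have : (\int[mu]_(x in Y) f x <= \int[mu]_(x in Y) (cst k%:R%:E) x)%E.
  apply: ge0_le_integral => //; first by move=> x _; exact: nneseries_ge0.
  exact: measurable_funTS.
rewrite intY integral_cst // leye_eq => /eqP kY.
by have := mufinE Y mY; rewrite -(fineK (mufinE Y mY)) -EFinM in kY.
Qed.

End divergent_weight.

(** * Random bipartite graphs *)

Section random_cuts.
Local Open Scope ring_scope.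
Variable R : realType.

Lemma lebesgue_measure_shift (t : R) (A : set R) : measurable A ->
  lebesgue_measure ((fun x => x - t) @^-1` A) = lebesgue_measure A.
Proof.
move=> mA; pose h := (fun x => x - t) : measurableTypeR R -> measurableTypeR R.
have mh : measurable_fun setT h by exact: measurable_funB.
apply/esym/(@lebesgue_measure_unique R (pushforward lebesgue_measure h)) => //.
move=> _ [[a b]] _ <-; rewrite /pushforward.
rewrite [X in _ = lebesgue_measure X](_ : _ = `]a + t, b + t]%classic); last first.
  by apply/seteqP; split=> x /=; rewrite !in_itv /= ltrBrDr lerBlDr.
rewrite !lebesgue_measure_itv /= !lte_fin ltrD2r -!EFinB.
by rewrite opprD addrACA subrr addr0.
Qed.

Definition digit (i : nat) (x : R) : bool := odd (Num.truncn (x * 2 ^+ i)).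

Lemma measurable_digit i : measurable [set x | digit i x].
Proof.
pose g (x : R) : R := (Num.truncn (x * 2 ^+ i))%:R.
have mg : measurable_fun setT g.
  apply: nondecreasing_measurable => // x y xy.
  by rewrite ler_nat le_truncn // ler_pM2r // exprn_gt0.
have -> : [set x | digit i x] =
    \bigcup_(k in [set k | odd k]) (g @^-1` [set k%:R]).
  apply/seteqP; split=> [x dx|x [k /= ok /eqP]].
    by exists (Num.truncn (x * 2 ^+ i)).
  by rewrite eqr_nat => /eqP; rewrite /digit => ->.
apply: bigcup_measurable => k _.
by rewrite -[X in measurable X]setTI; apply: mg => //; exact: measurable_set1.
Qed.

Lemma measurable_digit_neq i j : measurable [set x | digit i x != digit j x].
Proof.
have -> : [set x | digit i x != digit j x] =
    ([set x | digit i x] `\` [set x | digit j x]) `|`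
    ([set x | digit j x] `\` [set x | digit i x]).
  apply/seteqP; split=> x /=; case: (digit i x); case: (digit j x) => //=.
  - by left.
  - by right.
  - by case=> -[].
  - by case=> -[].
by apply: measurableU; apply: measurableD; exact: measurable_digit.
Qed.

Lemma digit_shift i x : 0 <= x -> digit i (x + 2 ^- i) = ~~ digit i x.
Proof.
move=> x0; rewrite /digit mulrDl mulVf ?expf_neq0// addrC truncnD ?rpred1//.
  by rewrite truncn1.
by rewrite nnegrE mulr_ge0 // exprn_ge0.
Qed.

Lemma digit_shift_lt i j x : (i < j)%N -> 0 <= x ->
  digit j (x + 2 ^- i) = digit j x.
Proof.
move=> ij x0; rewrite /digit mulrDl -(subnKC ij) exprD exprS.
set k := (j - i.+1)%N.
have -> : 2 ^- i * (2 * 2 ^+ i * 2 ^+ k) = (2 * 2 ^ k)%N%:R :> R.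
  rewrite natrM natrX mulrA [2 * 2 ^+ i]mulrC mulrA.
  by rewrite mulVf ?mul1r ?expf_neq0.
rewrite addrC truncnD ?natr_nat //; last first.
  by rewrite nnegrE !mulr_ge0 // exprn_ge0.
by rewrite natrK oddD oddM.
Qed.

(** Twice the unit interval, to leave room for translating [0, 1[ by at most 1. *)
Let D : set R := `[0, 2[%classic.
Let mD : measurable D. Proof. exact: measurable_itv. Qed.
Let mu := mrestr (@lebesgue_measure R) mD.

(** Translation by 2 to the power [- i] flips digit [i] and keeps digit [j]; so
    it maps the points of [0, 1[ with equal digits into points of [0, 2[ with
    distinct digits. Half of the measure 1 of [0, 1[ is therefore a lower bound,
    whatever carries occur between the digits. *)
Lemma measure_digit_neq i j : (i < j)%N ->
  ((2^-1)%:E <= mu [set x | digit i x != digit j x])%E.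
Proof.
move=> ij; set E := [set x | _].
have mE : measurable E := measurable_digit_neq i j.
pose I : set R := `[0, 1[%classic.
have mI : measurable I by exact: measurable_itv.
pose h (x : R) := x - 2 ^- i.
have sub1 : I `&` E `<=` E `&` D.
  move=> x [+ Ex]; rewrite /I /D /= !in_itv /= => /andP[-> x1]; split=> //.
  by rewrite (lt_trans x1) // ltr1n.
have sub2 : h @^-1` (I `\` E) `<=` E `&` D.
  move=> x [/=]; rewrite /h /I /D /= !in_itv /= => /andP[h0 h1] nE.
  have xE : x = (x - 2 ^- i) + 2 ^- i by rewrite subrK.
  split; first rewrite /E /= xE digit_shift // digit_shift_lt //.
    by move/negP: nE; rewrite /E /= negbK => /eqP->; case: (digit j _).
  have i1 : 2 ^- i <= 1 :> R.
    by rewrite invf_le1 ?exprn_gt0 // exprn_ege1 // ler1n.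
  rewrite xE addr_ge0 ?invr_ge0 ?exprn_ge0 //=.
  by rewrite -[2]/(1 + 1) ltr_leD.
have : ((1%:E : \bar R) <= mu E + mu E)%E.
  have <- : lebesgue_measure I = (1%:E : \bar R).
    by rewrite lebesgue_measure_itv /= lte_fin ltr01 oppr0 adde0.
  have -> : lebesgue_measure I =
      (lebesgue_measure (I `\` E) + lebesgue_measure (I `&` E))%E.
    exact: measureDI.
  apply: leeD.
    rewrite -(lebesgue_measure_shift (2 ^- i)); last exact: measurableD.
    apply: le_measure; rewrite ?inE; [|exact: measurableI|exact: sub2].
    rewrite -[X in measurable X]setTI; apply: measurable_funB => //.
    exact: measurableD.
  by apply: le_measure; rewrite ?inE //; exact: measurableI.
case: (mu E) => [r||]; [|by move=> _; rewrite leey|by []].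
rewrite -EFinD !lee_fin => r1.
by rewrite -[leLHS]mul1r ler_pdivrMr // mulr_natr mulr2n.
Qed.

(** The complete bipartite graph between the vertices [i] with digit 0 and those
    with digit 1. *)
Definition cut_graph (x : R) : set nat :=
  pair_code @` [set ij | ij.1 < ij.2 /\ digit ij.1 x != digit ij.2 x]%N.

Lemma ramsey_ideal_cut_graph x : ramsey_ideal (cut_graph x).
Proof.
eexists; last reflexivity; split=> [ij [ij12 _] //|B Binf BE].
have unbounded n : exists2 m, B m & (n < m)%N.
  apply: contrapT => nB; apply: Binf.
  apply: (sub_finite_set _ (finite_II n.+1)) => m Bm /=.
  by rewrite ltnS leqNgt; apply/negP => nm; apply: nB; exists m.
have [i Bi _] := unbounded 0%N.
have [j Bj ij] := unbounded i.
have [k Bk jk] := unbounded j.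
have [] := BE (i, j); first by split.
have [] := BE (j, k); first by split.
have [] := BE (i, k); first by split=> //; exact: ltn_trans jk.
move=> /= _ + _ + _; move: (digit i x) (digit j x) (digit k x).
by case=> [] [] [].
Qed.

Lemma cut_graph_pair_code x i j : (i < j)%N ->
  cut_graph x (pair_code (i, j)) <-> digit i x != digit j x.
Proof.
move=> ij; have [_ inj _] := pair_code_bij.
split=> [[[k l] [/= kl dkl] e]|dij]; last by exists (i, j).
have [] : (k, l) = (i, j) by apply: inj e; rewrite inE.
by move=> <- <-.
Qed.

(** * The Ramsey ideal is not below the summable ideal *)

(** The induction runs along one derivation that [s] is forced into the set of
    all numbers: it is a well-founded tree that does not depend on [x]. The
    events produced at its nodes are sufficient conditions for not being forced,
    so only these have to be measurable. *)
Lemma often_unforced phi s : forced phi (dual (summable_ideal R)) setT s ->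
  exists E : set R, [/\ measurable E, ((2^-1)%:E <= mu E)%E &
    forall x, E x -> ~ forced phi (dual (summable_ideal R)) (~` cut_graph x) s].
Proof.
elim=> {s} [s v phis _|s N phis FN _ IH].
  have [_ _ /(_ v Logic.I)[[i j] [_ _ /= ij] vE]] := pair_code_bij.
  exists [set x | digit i x != digit j x].
  split; [exact: measurable_digit_neq | exact: measure_digit_neq|].
  move=> x dij; case=> [w|?]; rewrite phis // => -[<-]; apply; rewrite -vE.
  exact/(cut_graph_pair_code x ij).
have /choice[B HB] : forall n, exists E : set R, [/\ measurable E,
    ((2^-1)%:E <= mu E)%E & N n -> forall x, E x ->
      ~ forced phi (dual (summable_ideal R)) (~` cut_graph x) (rcons s n)].
  move=> n; have [/IH[E [mE muE nE]]|nN] := pselect (N n); first by exists E.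
  exists setT; split=> //; apply: le_trans (measure_digit_neq (ltn0Sn 0)) _.
  by apply: le_measure; rewrite ?inE //; exact: measurable_digit_neq.
(* nothing is known about the successors outside [N], so they get weight 0 *)
pose w n : R := if n \in N then n.+1%:R^-1 else 0.
have w0 n : 0 <= w n by rewrite /w; case: ifP => // _; rewrite invr_ge0.
have mB n : measurable (B n) by have [] := HB n.
have muB n : ((2^-1)%:E <= mu (B n))%E by have [] := HB n.
exists [set x | \esum_(n in [set n | B n x]) (w n)%:E = +oo%E].
split.
- exact: measurable_divergent_weight w0 mB.
- apply: ge_measure_divergent_weight => //; last exact: esum_dual_summable.
  rewrite [X in (X < _)%E](_ : _ = lebesgue_measure D); last first.
    by congr (lebesgue_measure _); exact: setTI.
  by rewrite lebesgue_measure_itv /= lte_fin ltr0n oppr0 adde0 ltry.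
- move=> x /= xdvg.
  move=> /(forcedS _ (upper_set_dual (@lower_set_summable_ideal R)) phis) sfin.
  suff : (\esum_(n in [set n | B n x]) (w n)%:E < +oo)%E by rewrite xdvg ltxx.
  apply: (le_lt_trans _ sfin).
  rewrite esum_mkcond [leRHS]esum_mkcond; apply: le_esum => n _.
  case: ifPn => [|_]; last by case: ifP => // _; exact: weight_ge0.
  rewrite /w inE /= => Bnx; case: ifPn => [|_].
    rewrite inE => Nn; have [_ _ /(_ Nn x Bnx) nf] := HB n.
    by rewrite mem_set.
  by case: ifP => // _; exact: weight_ge0.
Qed.

Lemma ramsey_not_below_summable : ~ LT_lower ramsey_ideal (summable_ideal R).
Proof.
move=> /LT_upper_forced[||phi Hphi].
- exact: upper_set_dual (@lower_set_summable_ideal R).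
- by rewrite /dual /= setC0; exact: summable_ideal_setT.
have [|E [_ muE Eunforced]] := @often_unforced phi [::].
  apply: Hphi; rewrite /dual /= setCT.
  exact: lower_set_ramsey_ideal (@sub0set _ _) (ramsey_ideal_cut_graph 0).
have [x Ex] : E !=set0.
  apply/set0P; apply/eqP => e0; move: muE.
  rewrite e0 /mu /mrestr set0I measure0 lee_fin.
  by rewrite leNgt invr_gt0 ltr0n.
apply: (Eunforced x Ex); apply: Hphi; rewrite /dual /= setCK.
exact: ramsey_ideal_cut_graph.
Qed.

End random_cuts.

Theorem theoremC (R : realType) :
  ~ LT_lower (summable_ideal R) ramsey_ideal /\
  ~ LT_lower ramsey_ideal (summable_ideal R).
Proof.
split; [exact: summable_not_below_ramsey | exact: ramsey_not_below_summable].
Qed.
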